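(* Let $A$ be a Nakayama algebra with $n\geq 2$ simple modules and Kupisch series $(c_0,\dots,c_{n-1})$. An indecomposable module of the form $e_iA/e_iJ^k$ (with $1\leq k\leq c_i$) is $1$-rigid if and only if $1\leq k\leq n-1$ or $k>c_i-n$. The number of (isomorphism classes of) indecomposable $1$-rigid $A$-modules is therefore bounded by $n(n-1)+n^2$. In particular $o_1(A)\leq n(n-1)+n^2$ is bounded by a function depending only on the number $n$ of simple modules.
   Context: $A$ is a finite dimensional connected non-semisimple Nakayama algebra over a field $K$, given by quiver and relations, so its quiver is a directed line or a directed circle; modules are finite dimensional right modules. The vertices are numbered $0,1,\dots,n-1$ in a clockwise way, with corresponding primitive idempotents $e_i$, and $J$ is the Jacobson radical. $c_i=\dim_K(e_iA)$ is the dimension of the indecomposable projective module $e_iA$; the sequence $(c_0,\dots,c_{n-1})$ is the Kupisch series. Every indecomposable $A$-module is isomorphic to some $e_iA/e_iJ^k$ with $k\in\{1,\dots,c_i\}$. A module $M$ is $1$-rigid if $\operatorname{Ext}^1_A(X,Y)=0$ for all $X,Y\in\operatorname{add}(M)$ (equivalently $\operatorname{Ext}^1_A(M,M)=0$), where $\operatorname{add}(M)$ consists of direct summands of $M^m$, $m\ge 1$. $\operatorname{size}(M)$ is the number of pairwise non-isomorphic indecomposable direct summands of $M$, and $o_1(A):=\sup\{\operatorname{size}(M)\mid M\in\operatorname{mod}\text{-}A \text{ is } 1\text{-rigid}\}$. *)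

(* Defs.v *)
From HB Require Import structures.
From mathcomp Require Import all_boot all_order all_algebra all_field.
From mathcomp Require Import boolp.

Set Implicit Arguments.
Unset Strict Implicit.
Unset Printing Implicit Defensive.

Import Order.TTheory GRing.Theory Num.Theory.
Local Open Scope ring_scope.

Section Ideals.
Variables (K : fieldType) (A : falgType K).
Implicit Types (U V W : {vspace A}) (e : A).

Definition right_ideal U : Prop := (U * fullv <= U)%VS.
Definition left_ideal U : Prop := (fullv * U <= U)%VS.

Definition maximal_right_ideal U : Prop :=
  [/\ right_ideal U, U <> fullv &
      forall V, right_ideal V -> (U <= V)%VS -> V = U \/ V = fullv].

(* [{vspace A}] has no infinite intersections a priori, hence this lemma and
   the choice below; the characterisation of [jacobson] is [jacobsonP]. *)
Lemma jacobson_subproof : exists J : {vspace A},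
  forall x, x \in J <-> (forall m, maximal_right_ideal m -> x \in m).
Proof.
pose B U := forall m, maximal_right_ideal m -> (U <= m)%VS.
have B0 : exists d, `[< exists2 U, B U & \dim U = d >].
  exists 0%N; apply/asboolP; exists 0%VS; last by rewrite dimv0.
  by move=> m _; apply: sub0v.
have Bmax d : `[< exists2 U, B U & \dim U = d >] -> (d <= dim A)%N.
  by move=> /asboolP[U _ <-]; rewrite -dimvf; apply: dimvS (subvf U).
case: (ex_maxnP B0 Bmax) => d /asboolP[J BJ dJ] dmax.
exists J => x; split=> [xJ m mm|xm]; first exact: subvP (BJ m mm) x xJ.
have BJx : B (J + <[x]>)%VS.
  by move=> m mm; rewrite subv_add BJ //= -memvE xm.
have le_d : (\dim (J + <[x]>) <= d)%N by apply: dmax; apply/asboolP; exists (J + <[x]>)%VS.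
have /eqP -> : J == (J + <[x]>)%VS.
  by rewrite -(geq_leqif (dimv_leqif_eq (addvSl J <[x]>))) dJ.
by apply: subvP (addvSr J <[x]>) _ _; rewrite memv_line.
Qed.

Definition jacobson : {vspace A} := projT1 (cid jacobson_subproof).

Lemma jacobsonP x :
  x \in jacobson <-> (forall m, maximal_right_ideal m -> x \in m).
Proof. exact: projT2 (cid jacobson_subproof) x. Qed.

Lemma jacobson_right_ideal : right_ideal jacobson.
Proof.
apply/prodvP => x a xJ _; apply/jacobsonP => m mm.
have [rm _ _] := mm; apply: subvP rm _ _; apply: memv_mul (memvf a).
exact: (jacobsonP x).1 xJ m mm.
Qed.

(* [U ^+ 0] is [<[1]>] for vector spaces; the left factor [fullv] makes this
   the ideal J^k for every k, including J^0 = A. *)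
Definition jacobson_pow (k : nat) : {vspace A} := (fullv * jacobson ^+ k)%VS.

Definition proj_space e : {vspace A} := (<[e]> * fullv)%VS.
Definition proj_rad_space e (k : nat) : {vspace A} := (<[e]> * jacobson_pow k)%VS.

Lemma proj_space_right_ideal e : right_ideal (proj_space e).
Proof. by rewrite /right_ideal /proj_space -prodvA prodvSr // subvf. Qed.

Lemma proj_rad_space_right_ideal e k : right_ideal (proj_rad_space e k).
Proof.
rewrite /right_ideal /proj_rad_space /jacobson_pow -!prodvA.
case: k => [|k]; first by rewrite expv0 !prod1v prodv1 !prodvSr ?subvf.
by rewrite expvSr -!prodvA !prodvSr // jacobson_right_ideal.
Qed.

Definition idempotent e : Prop := e * e = e.

Definition primitive_idempotent e : Prop :=
  [/\ e <> 0, idempotent e &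
      forall f g, idempotent f -> idempotent g -> f * g = 0 -> g * f = 0 ->
        e = f + g -> f = 0 \/ g = 0].

(* The indecomposable projective right (left) modules are, up to isomorphism,
   the eA (Ae) with e primitive; their submodules are the right (left) ideals
   of A they contain. *)
Definition nakayama_algebra : Prop :=
  forall e, primitive_idempotent e ->
    (forall V W, right_ideal V -> right_ideal W ->
       (V <= proj_space e)%VS -> (W <= proj_space e)%VS ->
       (V <= W)%VS \/ (W <= V)%VS) /\
    (forall V W, left_ideal V -> left_ideal W ->
       (V <= fullv * <[e]>)%VS -> (W <= fullv * <[e]>)%VS ->
       (V <= W)%VS \/ (W <= V)%VS).

Definition connected_algebra : Prop :=
  forall e, idempotent e -> (forall a, e * a = a * e) -> e = 0 \/ e = 1.

Definition semisimple_algebra : Prop :=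
  forall U, right_ideal U ->
    exists W, [/\ right_ideal W, (U + W = fullv)%VS & (U :&: W = 0)%VS].

End Ideals.

Record quiver (V : finType) := Quiver {
  arrow : finType;
  src : arrow -> V;
  tgt : arrow -> V
}.

Definition directed_circle n : quiver 'I_n :=
  @Quiver _ 'I_n (fun i => i) (fun i => ordS i).

(* [ordS] wraps around only at n - 1, where no arrow of the line starts. *)
Definition directed_line n : quiver 'I_n :=
  @Quiver _ 'I_n.-1 (fun i => widen_ord (leq_pred n) i)
                    (fun i => ordS (widen_ord (leq_pred n) i)).

Section Presentation.
Variables (K : fieldType) (A : falgType K) (V : finType) (Q : quiver V).

Fixpoint is_qpath (v : V) (s : seq (arrow Q)) : bool :=
  if s is b :: s' then (src b == v) && is_qpath (tgt b) s' else true.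

(* A path is its starting vertex with its arrows in order of travel. *)
Definition qpath := {p : V * seq (arrow Q) | is_qpath p.1 p.2}.
Definition qlength (p : qpath) : nat := size (val p).2.

Definition qeval (e : V -> A) (x : arrow Q -> A) (p : qpath) : A :=
  e (val p).1 * \prod_(b <- (val p).2) x b.

(* An isomorphism of A with KQ/I for an admissible ideal I, given by the
   images of the vertices and of the arrows.  The first four equations are
   those of KQ; the last three conditions say that KQ -> A is surjective with
   kernel I such that R^m <= I <= R^2, where R is the arrow ideal (R^l has the
   paths of length >= l as a basis). *)
Record bound_quiver_presentation := BoundQuiverPresentation {
  vtx : V -> A;
  arr : arrow Q -> A;
  vtx_orth : forall i j, vtx i * vtx j = if i == j then vtx i else 0;
  vtx_sum : \sum_i vtx i = 1;
  vtx_src : forall b, vtx (src b) * arr b = arr b;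
  vtx_tgt : forall b, arr b * vtx (tgt b) = arr b;
  presentation_surj : forall a, exists (s : seq qpath) (c : qpath -> K),
    a = \sum_(p <- s) c p *: qeval vtx arr p;
  relations_sub_R2 : forall (s : seq qpath) (c : qpath -> K), uniq s ->
    \sum_(p <- s) c p *: qeval vtx arr p = 0 ->
    forall p, p \in s -> (qlength p <= 1)%N -> c p = 0;
  Rm_sub_relations : exists2 m, (2 <= m)%N &
    forall p, (m <= qlength p)%N -> qeval vtx arr p = 0
}.

Definition kupisch (P : bound_quiver_presentation) (i : V) : nat :=
  \dim (proj_space (vtx P i)).

End Presentation.

Record rmodule (K : fieldType) (A : falgType K) := RModule {
  carrier :> vectType K;
  act : carrier -> A -> carrier;
  act_linearl : forall a, linear (act^~ a);
  act_linearr : forall v, linear (act v);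
  act1 : forall v, act v 1 = v;
  actM : forall v a b, act v (a * b) = act (act v a) b
}.

Section Modules.
Variables (K : fieldType) (A : falgType K).
Implicit Types (M N X Y : rmodule A).

Definition mod_hom M N (f : 'Hom(M, N)) : Prop :=
  forall v a, f (act v a) = act (f v) a.

Definition mod_iso M N : Prop := exists2 f : 'Hom(M, N), mod_hom f & bijective f.

Definition regular_mod : rmodule A.
Proof.
refine (@RModule K A A (fun v a => v * a) _ _ _ _).
- by move=> a k u v /=; rewrite mulrDl scalerAl.
- by move=> v k a b /=; rewrite mulrDr scalerAr.
- exact: mulr1.
- exact: mulrA.
Defined.

Definition dsum M N : rmodule A.
Proof.
refine (@RModule K A (M * N)%type (fun v a => (act v.1 a, act v.2 a)) _ _ _ _).
- by move=> a k u v; congr pair; rewrite act_linearl.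
- by move=> v k a b; congr pair; rewrite act_linearr.
- by case=> u v; rewrite !act1.
- by move=> v a b; rewrite !actM.
Defined.

Definition mpow M (m : nat) : rmodule A.
Proof.
refine (@RModule K A {ffun 'I_m -> M} (fun v a => [ffun i => act (v i) a]) _ _ _ _).
- by move=> a k u v; apply/ffunP=> i; rewrite !ffunE act_linearl.
- by move=> v k a b; apply/ffunP=> i; rewrite !ffunE act_linearr.
- by move=> v; apply/ffunP=> i; rewrite !ffunE act1.
- by move=> v a b; apply/ffunP=> i; rewrite !ffunE actM.
Defined.

Section Subquotient.
Variables (M : rmodule A) (U W : {vspace M}).
Hypothesis (stU : forall v a, v \in U -> act v a \in U).
Hypothesis (stW : forall v a, v \in W -> act v a \in W).

(* The carrier of (U + W) / W is the complement [U :\: W] of [U :&: W] in U,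
   identified with the quotient along the projection [subquot_proj] of U;
   [subquot_projP] states the first isomorphism theorem for it. *)
Definition subquot_proj (v : M) : subvs_of (U :\: W)%VS :=
  vsproj (U :\: W)%VS (addv_pi1 U W v).

Lemma subquot_proj_linear : linear subquot_proj.
Proof. by move=> k u v; rewrite /subquot_proj !linearP. Qed.

Lemma val_subquot_proj v : vsval (subquot_proj v) = addv_pi1 U W v.
Proof. by rewrite vsprojK // /addv_pi1 memv_pi. Qed.

Lemma subquot_projK (u : subvs_of (U :\: W)%VS) : subquot_proj (vsval u) = u.
Proof.
apply: val_inj; rewrite /= val_subquot_proj /addv_pi1 daddv_pi_id ?subvsP //.
by rewrite capv_diff.
Qed.

Lemma subquot_proj0 v : v \in U -> subquot_proj v = 0 <-> v \in W.
Proof.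
move=> vU; have vUW : v \in (U + W)%VS by apply: subvP (addvSl U W) _ vU.
split=> [v0|vW].
  rewrite -(addv_pi1_pi2 vUW) -val_subquot_proj v0 /= add0r.
  exact: memv_pi2.
apply: val_inj; rewrite /= val_subquot_proj.
apply: (addIr (addv_pi2 U W v)); rewrite addv_pi1_pi2 //= add0r.
by rewrite addv_pi2_id.
Qed.

Lemma subquot_proj_act v a : v \in U ->
  subquot_proj (act (vsval (subquot_proj v)) a) = subquot_proj (act v a).
Proof.
move=> vU; have vUW : v \in (U + W)%VS by apply: subvP (addvSl U W) _ vU.
rewrite val_subquot_proj.
have pU : addv_pi1 U W v \in U by apply: memv_pi1.
have actB (x y : M) : act (x - y) a = act x a - act y a.
  by rewrite (addrC x) -scaleN1r act_linearl scaleN1r addrC.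
have projB (x y : M) : subquot_proj (x - y) = subquot_proj x - subquot_proj y.
  by rewrite (addrC x) -scaleN1r subquot_proj_linear scaleN1r addrC.
apply/eqP; rewrite eq_sym -subr_eq0 -projB -actB; apply/eqP.
apply/subquot_proj0; first by apply: stU; rewrite rpredB.
by apply: stW; rewrite -{1}(addv_pi1_pi2 vUW) addrC addKr memv_pi2.
Qed.

Definition subquotient : rmodule A.
Proof.
refine (@RModule K A (subvs_of (U :\: W)%VS)
          (fun v a => subquot_proj (act (vsval v) a)) _ _ _ _).
- by move=> a k u v; rewrite linearP act_linearl subquot_proj_linear.
- by move=> v k a b; rewrite act_linearr subquot_proj_linear.
- by move=> v; rewrite act1 subquot_projK.
- move=> v a b; rewrite actM subquot_proj_act //.
  by apply: stU; apply: subvP (diffvSl U W) _ (subvsP v).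
Defined.

Lemma subquot_projP :
  [/\ linear (subquot_proj : M -> subquotient),
      forall v a, v \in U ->
        subquot_proj (act v a) = act (subquot_proj v : subquotient) a,
      forall w : subquotient, exists2 v, v \in U & subquot_proj v = w &
      forall v, v \in U -> subquot_proj v = 0 <-> v \in W].
Proof.
split; [exact: subquot_proj_linear| | |exact: subquot_proj0].
- by move=> v a vU /=; rewrite subquot_proj_act.
- move=> w; exists (vsval w); last exact: subquot_projK.
  by apply: subvP (diffvSl U W) _ (subvsP w).
Qed.

End Subquotient.

Lemma right_ideal_act (U : {vspace A}) : right_ideal U ->
  forall (v : regular_mod) a, v \in U -> act v a \in U.
Proof. by move=> rU v a vU; apply: subvP rU _ _; apply: memv_mul (memvf a). Qed.

(* eA / eJ^k *)
Definition proj_quot (e : A) (k : nat) : rmodule A :=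
  @subquotient regular_mod (proj_space e) (proj_rad_space e k)
    (right_ideal_act (proj_space_right_ideal e))
    (right_ideal_act (proj_rad_space_right_ideal e k)).

Definition zero_mod M : Prop := dim M = 0%N.

Definition direct_summand X M : Prop := exists N, mod_iso M (dsum X N).

Definition indecomposable M : Prop :=
  ~ zero_mod M /\
  forall X Y, mod_iso M (dsum X Y) -> zero_mod X \/ zero_mod Y.

Definition add_closure M X : Prop :=
  exists2 m, (1 <= m)%N & direct_summand X (mpow M m).

(* A short exact sequence 0 -> Y -> E -> X -> 0. *)
Record extension X Y := Extension {
  ext_mid : rmodule A;
  ext_inc : 'Hom(Y, ext_mid);
  ext_prj : 'Hom(ext_mid, X);
  ext_inc_hom : mod_hom ext_inc;
  ext_prj_hom : mod_hom ext_prj;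
  ext_inc_inj : lker ext_inc = 0%VS;
  ext_exact : limg ext_inc = lker ext_prj;
  ext_prj_surj : limg ext_prj = fullv
}.

Definition ext_equiv X Y (E F : extension X Y) : Prop :=
  exists h : 'Hom(ext_mid E, ext_mid F),
    [/\ mod_hom h, bijective h,
        (h \o ext_inc E)%VF = ext_inc F & (ext_prj F \o h)%VF = ext_prj E].

Definition split_inc X Y : 'Hom(Y, dsum Y X) := linfun (fun y => (y, 0)).
Definition split_prj X Y : 'Hom(dsum Y X, X) := linfun snd.

Lemma split_incE X Y y : split_inc X Y y = (y, 0).
Proof.
pose f (y : Y) : dsum Y X := (y, 0).
have fl : linear f by move=> k u v; congr pair; rewrite /= scaler0 addr0.
pose F : {linear Y -> dsum Y X} := HB.pack f (GRing.isLinear.Build _ _ _ _ f fl).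
exact: (lfunE F).
Qed.

Lemma split_prjE X Y v : split_prj X Y v = v.2.
Proof. exact: lfunE. Qed.

Lemma act0l M (a : A) : act (0 : M) a = 0.
Proof.
by have := act_linearl a (-1) (0 : M) 0; rewrite scaler0 addr0 scaleN1r addNr.
Qed.

Definition split_extension X Y : extension X Y.
Proof.
refine (@Extension X Y (dsum Y X) (split_inc X Y) (split_prj X Y) _ _ _ _ _).
- by move=> v a; rewrite !split_incE /= act0l.
- by move=> v a; rewrite !split_prjE.
- by apply/eqP/lker0P => u v; rewrite !split_incE => -[].
- apply/vspaceP => v; rewrite memv_ker split_prjE.
  apply/memv_imgP/eqP => [[y _ ->]|v0]; first by rewrite split_incE.
  by exists v.1; rewrite ?memvf // split_incE -v0; case: v {v0}.
- apply/vspaceP => x; rewrite memvf; apply/memv_imgP.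
  by exists (0, x); rewrite ?memvf // split_prjE.
Defined.

(* Ext^1_A(X, Y) is the set of equivalence classes of extensions of X by Y,
   with the class of the split extension as zero. *)
Definition Ext1_zero X Y : Prop :=
  forall E : extension X Y, ext_equiv E (split_extension X Y).

Definition rigid1 M : Prop :=
  forall X Y, add_closure M X -> add_closure M Y -> Ext1_zero X Y.

End Modules.

(* Natural numbers extended by infinity, encoded as [None]. *)
Definition enat := option nat.

Definition enat_le (x y : enat) : bool :=
  match x, y with
  | _, None => true
  | None, Some _ => false
  | Some a, Some b => (a <= b)%N
  end.

Definition enat_bounded (S : enat -> Prop) : Prop :=
  exists b, `[< forall x, S x -> enat_le x (Some b) >].

Definition enat_sup (S : enat -> Prop) : enat :=
  if pselect (enat_bounded S) is left h then Some (ex_minn h) else None.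

Lemma enat_supP (S : enat -> Prop) y :
  enat_le (enat_sup S) y <-> (forall x, S x -> enat_le x y).
Proof.
rewrite /enat_sup; case: pselect => [h|h]; last first.
  case: y => [b|]; last by split=> // _ [].
  by split=> // Sb; case: h; exists b; apply/asboolP.
case: ex_minnP => m /asboolP Sm mmin; split=> [|Sy].
  by case: y => [b|] /= mb [a|] /Sm //= am; apply: leq_trans am mb.
by case: y Sy => //= b Sb; apply: mmin; apply/asboolP.
Qed.

Section Counting.
Variables (K : fieldType) (A : falgType K).

(* [f] enumerates the modules satisfying [P] up to isomorphism, without
   repetition. *)
Definition iso_transversal (P : rmodule A -> Prop) s (f : 'I_s -> rmodule A) :=
  [/\ forall i, P (f i),
      forall i j, mod_iso (f i) (f j) -> i = j &
      forall M, P M -> exists i, mod_iso M (f i)].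

Definition num_iso_classes (P : rmodule A -> Prop) : enat :=
  if pselect (exists s, exists f : 'I_s -> rmodule A, iso_transversal P f)
    is left h then Some (projT1 (cid h)) else None.

Definition size_mod (M : rmodule A) : enat :=
  num_iso_classes (fun N => indecomposable N /\ direct_summand N M).

Definition o1 : enat :=
  enat_sup (fun s => exists2 M : rmodule A, rigid1 M & s = size_mod M).

End Counting.

(* Main.v *)
Require Import Defs.
From mathcomp Require Import all_boot all_order all_algebra all_field.
From HB Require Import structures.
From mathcomp Require Import boolp zify.

(** Let [p i l] be the product of the [l] consecutive arrows that start at the
    vertex [i]; it is zero when the quiver is a line that ends too early, so
    that the line and the circle are treated alike.  Every element of e_iA is
    a combination of the [p i l], whence e_iJ^k = p_{i,k}A ([proj_rad_spaceE])
    and c_i is the least [l] with [p i l = 0] ([path_eq0]).  The module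
    M = e_iA/e_iJ^k is uniserial: any nonzero [w] in M can be multiplied by a
    path into the socle K p_{i,k-1}, and the length of that path is known
    modulo n as soon as [w] lies in some M e_d ([serial_socle]).

    Why M is rigid when k < n or k > c_i - n ([serial_rigid]).  The obstruction
    to splitting an extension of M by a module Y is a map e_iJ^k -> Y, that is
    an element [y] of Y e_{i+k} killed by [p (i+k) (c_i-k)]: lift the generator
    of M to [z] and take y = z p_{i,k}.  If Y embeds in a power of M then y = 0.
    Indeed a component w <> 0 of [y] has leading term p_{i,j} with j < k and
    j = k modulo n, so that j <= k - n; this excludes k < n, and if c_i - k < n
    the path of length k-1-j that carries [w] into the socle factors through
    [p (i+k) (c_i-k)], which kills [w].  Thus the lift of the generator already
    defines a section.  Modules X in add(M) reduce to X = M because X is a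
    retract of a power of M.

    Why M is not rigid when n <= k <= c_i - n ([serial_not_rigid]).  There is
    a nonsplit exact sequence
      0 -> M -> e_iA/e_iJ^{k+n} (+) e_iA/e_iJ^{k-n} -> M -> 0,
    whose middle term is not killed by J^k, whereas M (+) M is.

    Why there are at most n(n-1)+n^2 classes.  An indecomposable module M
    contains a copy of some e_iA/e_iJ^k with [k] the Loewy length of M; a linear
    form that is nonzero on its socle yields a homomorphism M -> e_iA/e_iJ^k
    that is injective on this copy, so the copy is a direct summand, hence M
    ([indecomposable_serial]).  For each [i], at most (n-1)+n values of [k] give
    a rigid module.  Direct summands of a rigid module are rigid, so the same
    list bounds [o1 A]. *)

Set Implicit Arguments.
Unset Strict Implicit.
Unset Printing Implicit Defensive.

Import Order.TTheory GRing.Theory Num.Theory.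
Local Open Scope ring_scope.

(** * Homomorphisms, retracts and split extensions *)

Section ModuleHoms.
Variables (K : fieldType) (A : falgType K).
Implicit Types (L M N X Y : rmodule A).

Lemma actDl M (u v : M) (a : A) : act (u + v) a = act u a + act v a.
Proof. by have := act_linearl a 1 u v; rewrite !scale1r. Qed.

Lemma actZl M (c : K) (v : M) (a : A) : act (c *: v) a = c *: act v a.
Proof. by have := act_linearl a c v 0; rewrite act0l !addr0. Qed.

Lemma actBl M (u v : M) (a : A) : act (u - v) a = act u a - act v a.
Proof. by rewrite -[- v]scaleN1r actDl actZl scaleN1r. Qed.

Lemma actDr M (v : M) (a b : A) : act v (a + b) = act v a + act v b.
Proof. by have := act_linearr v 1 a b; rewrite !scale1r. Qed.

Lemma act0r M (v : M) : act v (0 : A) = 0.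
Proof. by apply: (addrI (act v (0 : A))); rewrite -actDr !addr0. Qed.

Lemma actZr M (c : K) (v : M) (a : A) : act v (c *: a) = c *: act v a.
Proof. by have := act_linearr v c a 0; rewrite act0r !addr0. Qed.

Lemma actBr M (v : M) (a b : A) : act v (a - b) = act v a - act v b.
Proof. by rewrite -[- b]scaleN1r actDr actZr scaleN1r. Qed.

Lemma act_suml M I (r : seq I) (P : pred I) (F : I -> M) (a : A) :
  act (\sum_(i <- r | P i) F i) a = \sum_(i <- r | P i) act (F i) a.
Proof.
by elim/big_rec2: _ => [|i u v _ <-]; [exact: act0l | rewrite actDl].
Qed.

Lemma act_sumr M I (r : seq I) (P : pred I) (F : I -> A) (v : M) :
  act v (\sum_(i <- r | P i) F i) = \sum_(i <- r | P i) act v (F i).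
Proof.
by elim/big_rec2: _ => [|i u w _ <-]; [exact: act0r | rewrite actDr].
Qed.

Lemma mod_hom_of_linear M N (f : M -> N) : linear f ->
  (forall v a, f (act v a) = act (f v) a) ->
  exists2 F : 'Hom(M, N), mod_hom F & F =1 f.
Proof.
move=> fl fa.
pose L : {linear M -> N} := HB.pack f (GRing.isLinear.Build _ _ _ _ f fl).
have LE : linfun L =1 f by move=> v; rewrite lfunE.
by exists (linfun L) => // v a; rewrite !LE.
Qed.

Lemma mod_hom_id M : mod_hom (\1%VF : 'Hom(M, M)).
Proof. by move=> v a; rewrite !id_lfunE. Qed.

Lemma mod_hom_comp L M N (g : 'Hom(M, N)) (f : 'Hom(L, M)) :
  mod_hom g -> mod_hom f -> mod_hom (g \o f)%VF.
Proof. by move=> hg hf v a; rewrite !comp_lfunE hf hg. Qed.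

Lemma mod_iso_inv M N : mod_iso M N ->
  exists (f : 'Hom(M, N)) (g : 'Hom(N, M)),
    [/\ mod_hom f, mod_hom g, cancel f g & cancel g f].
Proof.
case=> f hf [g fK gK].
have gl : linear g by move=> k u v; apply: (can_inj fK); rewrite linearP /= !gK.
have ga v a : g (act v a) = act (g v) a.
  by apply: (can_inj fK); rewrite hf !gK.
have [G hG GE] := mod_hom_of_linear gl ga.
by exists f, G; split=> // v; rewrite GE.
Qed.

Lemma mod_iso_sym M N : mod_iso M N -> mod_iso N M.
Proof. by case/mod_iso_inv => f [g [_ hg fK gK]]; exists g => //; exists f. Qed.

Lemma mod_iso_trans L M N : mod_iso L M -> mod_iso M N -> mod_iso L N.
Proof.
case=> f hf bf [g hg bg]; exists (g \o f)%VF; first exact: mod_hom_comp.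
by apply: (eq_bij (bij_comp bg bf)) => v; rewrite comp_lfunE.
Qed.

Lemma mod_iso_refl M : mod_iso M M.
Proof.
exists \1%VF; first exact: mod_hom_id.
by exists id => v; rewrite id_lfunE.
Qed.

(** Membership in add(M) only enters through the two maps of a splitting, which
    compose and pass to powers without choosing complements. *)
Definition retract X M : Prop :=
  exists (f : 'Hom(X, M)) (g : 'Hom(M, X)),
    [/\ mod_hom f, mod_hom g & cancel f g].

Lemma retract_trans X M N : retract X M -> retract M N -> retract X N.
Proof.
case=> f [g [hf hg fK]] [f' [g' [hf' hg' fK']]].
exists (f' \o f)%VF, (g \o g')%VF; split; try exact: mod_hom_comp.
by move=> v; rewrite !comp_lfunE fK' fK.
Qed.

Lemma mod_iso_retract M N : mod_iso M N -> retract M N.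
Proof. by case/mod_iso_inv => f [g [hf hg fK _]]; exists f, g. Qed.

(** The complement of a retract is the kernel of the retraction. *)
Lemma direct_summandP X M : direct_summand X M <-> retract X M.
Proof.
split=> [[N /mod_iso_sym iso]|[f [g [hf hg fK]]]].
  have [F [G [hF hG FK]]] := mod_iso_retract (mod_iso_sym iso).
  apply: retract_trans (mod_iso_retract iso).
  have il : linear (fun x : X => (x, 0) : dsum X N).
    by move=> k u v; congr pair; rewrite /= scaler0 addr0.
  have ia v a : ((act v a, 0) : dsum X N) = act ((v, 0) : dsum X N) a.
    by rewrite /= act0l.
  have pl : linear (fun v : dsum X N => v.1) by [].
  have [I hI IE] := mod_hom_of_linear il ia.
  have [p hp pE] := @mod_hom_of_linear (dsum X N) X _ pl (fun _ _ => erefl).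
  by exists I, p; split=> // v; rewrite pE IE.
have stU v a : v \in lker g -> act v a \in lker g.
  by rewrite !memv_ker hg => /eqP ->; rewrite act0l.
have st0 v a : v \in 0%VS -> act v a \in (0%VS : {vspace M}).
  by rewrite !memv0 => /eqP ->; rewrite act0l.
exists (subquotient stU st0).
pose h (v : M) : dsum X (subquotient stU st0) :=
  (g v, @subquot_proj _ _ M (lker g) 0 (v - f (g v))).
have [pl pa _ p0] := subquot_projP stU st0.
have hU v : v - f (g v) \in lker g by rewrite memv_ker linearB /= fK subrr.
have hl : linear h.
  move=> k u v; rewrite /h; congr pair; first by rewrite linearP.
  rewrite -pl; congr (subquot_proj _ _ _).
  by rewrite (linearP g) (linearP f) scalerBr opprD addrACA.
have ha v a : h (act v a) = act (h v) a.
  rewrite /h; congr pair; first exact: hg.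
  by apply: etrans (pa _ _ (hU v)); rewrite actBl hg hf.
have [H hH HE] := mod_hom_of_linear hl ha; exists H => //.
have uP (w : subvs_of (lker g :\: 0)%VS) : vsval w \in lker g.
  exact: subvP (diffvSl _ _) _ (subvsP w).
have pK v : v \in lker g -> vsval (@subquot_proj _ _ M (lker g) 0 v) = v.
  move=> vU; apply/eqP; rewrite -subr_eq0 -memv0; apply/p0; first by rewrite rpredB.
  rewrite addrC -scaleN1r; apply: etrans (pl _ _ _) _.
  by rewrite (subquot_projK (subquot_proj _ _ v)) scaleN1r addNr.
exists (fun w => f w.1 + vsval w.2) => [v|[x w]]; rewrite HE /h /=.
  by rewrite pK // addrCA subrr addr0.
have gx : g (f x + vsval w) = x.
  by rewrite linearD /= fK; move/(_ w): uP; rewrite memv_ker => /eqP ->; rewrite addr0.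
by rewrite gx addrC addKr subquot_projK.
Qed.

(** By finite dimension [g \o f] is then an automorphism of [X], and its
    inverse turns [g] into a retraction of [f]. *)
Lemma retract_of_inj_endo X M (f : 'Hom(X, M)) (g : 'Hom(M, X)) :
  mod_hom f -> mod_hom g -> injective (g \o f) -> retract X M.
Proof.
move=> hf hg gfI; pose h : 'Hom(X, X) := (g \o f)%VF.
have hh : mod_hom h by apply: mod_hom_comp.
have h0 : lker h == 0%VS.
  by apply/lker0P => u v; rewrite !comp_lfunE => /gfI.
have hK := lker0_lfunK h0; have hVK := lker0_lfunVK h0.
exists f, (h^-1 \o g)%VF; split=> //.
  apply: mod_hom_comp => // v a; apply: (can_inj hK).
  by rewrite hh !hVK.
by move=> v; rewrite comp_lfunE; have := hK v; rewrite /= comp_lfunE.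
Qed.

Lemma retract_mpow X M m : retract X M -> retract (mpow X m) (mpow M m).
Proof.
case=> f [g [hf hg fK]].
have powl (U V : rmodule A) (h : 'Hom(U, V)) :
    linear ((fun u => [ffun i => h (u i)]) : mpow U m -> mpow V m).
  by move=> k u v; apply/ffunP => i; rewrite !ffunE linearP.
have powa (U V : rmodule A) (h : 'Hom(U, V)) : mod_hom h -> forall (u : mpow U m) (a : A),
    [ffun i => h ((act u a : mpow U m) i)] =
    act ([ffun i => h (u i)] : mpow V m) a.
  by move=> hh u a; apply/ffunP => i; rewrite !ffunE hh.
have [F hF FE] := mod_hom_of_linear (powl _ _ f) (powa _ _ f hf).
have [G hG GE] := mod_hom_of_linear (powl _ _ g) (powa _ _ g hg).
by exists F, G; split=> // u; rewrite GE FE; apply/ffunP => i; rewrite !ffunE fK.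
Qed.

Lemma retract_mpow1 M : retract M (mpow M 1).
Proof.
have il : linear ((fun v => [ffun=> v]) : M -> mpow M 1).
  by move=> k u v; apply/ffunP => i; rewrite !ffunE.
have pl : linear ((fun u => u ord0) : mpow M 1 -> M).
  by move=> k u v; rewrite !ffunE.
have [F hF FE] : exists2 F : 'Hom(M, mpow M 1), mod_hom F & F =1 (fun v => [ffun=> v]).
  by apply: mod_hom_of_linear il _ => v a; apply/ffunP => i; rewrite !ffunE.
have [G hG GE] : exists2 G : 'Hom(mpow M 1, M), mod_hom G & G =1 (fun u => u ord0).
  by apply: mod_hom_of_linear pl _ => v a; rewrite ffunE.
by exists F, G; split=> // v; rewrite GE FE ffunE.
Qed.

Lemma add_closure_retract M N X : retract N M -> add_closure N X -> add_closure M X.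
Proof.
move=> NM [m m1 /direct_summandP XN]; exists m => //; apply/direct_summandP.
exact: retract_trans XN (retract_mpow m NM).
Qed.

Lemma rigid1_retract M N : retract N M -> rigid1 M -> rigid1 N.
Proof. by move=> NM rM X Y XN YN; apply: rM; apply: add_closure_retract NM _. Qed.

Lemma add_closure_refl M : add_closure M M.
Proof. by exists 1%N => //; apply/direct_summandP; apply: retract_mpow1. Qed.

Lemma zero_modP M : zero_mod M <-> forall v : M, v = 0.
Proof.
rewrite /zero_mod -dimvf; split=> [/eqP|z].
  by rewrite dimv_eq0 => /eqP f0 v; apply/eqP; rewrite -memv0 -f0 memvf.
by apply/eqP; rewrite dimv_eq0; apply/eqP/vspaceP => v; rewrite (z v) !mem0v.
Qed.

Lemma indecomposable_retract X M :
  indecomposable M -> ~ zero_mod X -> retract X M -> mod_iso M X.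
Proof.
case=> _ ind nX /direct_summandP[N iso].
have /zero_modP N0 : zero_mod N by case: (ind X N iso).
apply: mod_iso_trans iso _.
have pl : linear (fun v : dsum X N => v.1) by [].
have [p hp pE] := @mod_hom_of_linear (dsum X N) X _ pl (fun _ _ => erefl).
exists p => //; exists (fun x => (x, 0)) => [[x w]|x]; rewrite pE //=.
by rewrite (N0 w).
Qed.

(** A section [s] of the projection identifies the middle term with Y (+) X by
    v |-> (v - s v, v). *)
Lemma ext_split X Y (E : extension X Y) (s : 'Hom(X, ext_mid E)) :
  mod_hom s -> cancel s (ext_prj E) -> ext_equiv E (split_extension X Y).
Proof.
move=> hs sK; set i := ext_inc E; set p := ext_prj E.
have hi : mod_hom i := @ext_inc_hom _ _ _ _ E.
have hp : mod_hom p := @ext_prj_hom _ _ _ _ E.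
have i0 : lker i == 0%VS by rewrite (ext_inc_inj E).
have iK := lker0_lfunK i0.
have iVK v : p v = 0 -> i (i^-1%VF v) = v.
  move=> pv; apply: limg_lfunVK; rewrite (ext_exact E) memv_ker.
  exact/eqP.
have pi y : p (i y) = 0.
  by apply/eqP; rewrite -memv_ker -(ext_exact E) memv_img // memvf.
pose h (v : ext_mid E) : dsum Y X := (i^-1%VF (v - s (p v)), p v).
have pB v : p (v - s (p v)) = 0 by rewrite linearB /= sK subrr.
have hl : linear h.
  move=> k u v; rewrite /h; congr pair; last by rewrite linearP.
  rewrite /= -linearP; congr (_ _).
  by rewrite (linearP p) (linearP s) scalerBr opprD addrACA.
have ha v a : h (act v a) = act (h v) a.
  rewrite /h; congr pair => /=; last exact: hp.
  by rewrite hp hs -actBl; apply: (can_inj iK); rewrite hi !iVK // hp pB act0l.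
have [H hH HE] := mod_hom_of_linear hl ha; exists H; split=> //.
- exists (fun w => i w.1 + s w.2) => [v|[y x]]; rewrite HE /h /=.
    by rewrite iVK // subrK.
  have px : p (i y + s x) = x by rewrite linearD /= pi sK add0r.
  by rewrite px addrK iK.
- apply/lfunP => y; rewrite comp_lfunE HE split_incE /h pi.
  by rewrite linear0 subr0 iK.
- by apply/lfunP => v; rewrite comp_lfunE split_prjE HE.
Qed.

End ModuleHoms.

(** * Paths in a cyclically ordered set of arrows *)

Fixpoint arrow_path (K : fieldType) (A : falgType K) n (e x : 'I_n -> A)
    (i : 'I_n) (l : nat) : A :=
  if l is l'.+1 then x i * arrow_path e x (ordS i) l' else e i.

(** What is used of a presentation of [A] by the line or the circle.  The arrow
    [arrw i] leaves the vertex [i] and is zero if there is none, so that the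
    vertices are cyclically ordered in both cases; [idem_split] says that the
    top of the right ideal e_iA is spanned by e_i. *)
Record serial_generators (K : fieldType) (A : falgType K) (n : nat) :=
  SerialGenerators {
  idem : 'I_n -> A;
  arrw : 'I_n -> A;
  idem_orth : forall i j, idem i * idem j = if i == j then idem i else 0;
  idem_sum : \sum_i idem i = 1;
  arrw_src : forall i, idem i * arrw i = arrw i;
  arrw_tgt : forall i, arrw i * idem (ordS i) = arrw i;
  idem_neq0 : forall i, idem i != 0;
  idem_split : forall i a, exists c b, idem i * a = c *: idem i + arrw i * b;
  arrw_nilp : exists N, forall i, arrow_path idem arrw i N = 0
}.

Section Paths.
Variables (K : fieldType) (A : falgType K) (n : nat).
Variable G : serial_generators A n.
Notation e := (idem G).
Notation x := (arrw G).
Notation p := (arrow_path (idem G) (arrw G)).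
Notation s := (fun i l => iter l (@ordS n) i).

Lemma val_shift (i : 'I_n) l : val (s i l) = ((i + l) %% n)%N.
Proof.
elim: l => [|l IHl] /=; first by rewrite addn0 modn_small.
by rewrite IHl -addn1 modnDml addn1 addnS.
Qed.

Lemma shift_n (i : 'I_n) : s i n = i.
Proof. by apply: val_inj; rewrite val_shift modnDr modn_small. Qed.

Lemma path_src i l : e i * p i l = p i l.
Proof.
by case: l => [|l] /=; [rewrite idem_orth eqxx | rewrite mulrA arrw_src].
Qed.

Lemma path_cat i j l : p i (j + l) = p i j * p (s i j) l.
Proof.
elim: j i => [|j IHj] i; first by rewrite path_src.
by rewrite addSn iterSr /= IHj mulrA.
Qed.

Lemma path_tgt i l : p i l * e (s i l) = p i l.
Proof. by rewrite -(path_cat i l 0) addn0. Qed.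

Lemma path_rcons i l : p i l.+1 = p i l * x (s i l).
Proof. by rewrite -addn1 path_cat /= arrw_tgt. Qed.

Lemma path_arrow i j b : p i j * x b = if b == s i j then p i j.+1 else 0.
Proof.
case: eqP => [->|/eqP ne]; first by rewrite -path_rcons.
by rewrite -path_tgt -(arrw_src G b) mulrA -[_ * _ * e b]mulrA idem_orth eq_sym
  (negPf ne) mulr0 mul0r.
Qed.

Lemma path_mul i j b l : p i j * p b l = if b == s i j then p i (j + l) else 0.
Proof.
case: eqP => [->|/eqP ne]; first by rewrite -path_cat.
by rewrite -path_tgt -(path_src b) mulrA -[_ * _ * e b]mulrA idem_orth eq_sym
  (negPf ne) mulr0 mul0r.
Qed.

Lemma path_split i j a : exists c b, p i j * a = c *: p i j + p i j.+1 * b.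
Proof.
have [c [b E]] := idem_split G (s i j) a; exists c, b.
by rewrite -path_tgt -mulrA E mulrDr -scalerAr path_tgt mulrA -path_rcons.
Qed.

(** This is p_{i,j} A J^l <= p_{i,j+l}A.  For one arrow x_b, the part of
    p_{i,j} a in p_{i,j+1}A stays there, and the remaining multiple of [p i j]
    becomes a multiple of [p i j.+1]; induction on [l] does the rest. *)
Lemma path_mul_path i j a b l : exists d, p i j * a * p b l = p i (j + l) * d.
Proof.
elim: l j a b => [|l IHl] j a b; first by exists (a * e b); rewrite addn0 mulrA.
have [c [d E]] := path_split i j a; rewrite /= mulrA E mulrDl -scalerAl path_arrow.
have -> : c *: (if b == s i j then p i j.+1 else 0) + p i j.+1 * d * x b =
    p i j.+1 * ((if b == s i j then c%:A else 0) + d * x b).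
  case: ifP => _; rewrite mulrDr mulrA; last by rewrite mulr0 scaler0.
  by rewrite -scalerAr mulr1.
by rewrite addnS -addSn; apply: IHl.
Qed.

Lemma path_le i j k : (j <= k)%N -> exists b, p i k = p i j * b.
Proof. by move=> jk; exists (p (s i j) (k - j)); rewrite -path_cat subnKC. Qed.

Lemma path_eq0_le i j k : (j <= k)%N -> p i j = 0 -> p i k = 0.
Proof. by move=> /(path_le i)[b ->] ->; rewrite mul0r. Qed.

(** The chain e_iA = p_{i,0}A >= p_{i,1}A >= ... has steps of dimension at
    most one, so an element of e_iA outside p_{i,k}A has a leading term. *)
Lemma leading_term i k u : e i * u = u ->
  (exists a, u = p i k * a) \/
  exists j c b, [/\ (j < k)%N, c != 0 & u = c *: p i j + p i j.+1 * b].
Proof.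
move=> eu; elim: k => [|k [[a ->]|[j [c [b [jk c0 E]]]]]].
- by left; exists u; rewrite /= eu.
- have [c [b E]] := path_split i k a; have [c0|c0] := eqVneq c 0.
    by left; exists b; rewrite E c0 scale0r add0r.
  by right; exists k, c, b.
- by right; exists j, c, b; split=> //; apply: ltnW.
Qed.

(** Iterating the hypothesis pushes [p i j] into p_{i,j+m}A for all [m], hence
    to zero: this is Nakayama's lemma for the nilpotent ideal of the arrows. *)
Lemma path_nakayama i j a : p i j = p i j.+1 * a -> p i j = 0.
Proof.
move=> E; have step m : exists b, p i j = p i (j + m) * b.
  elim: m => [|m [b Em]]; first by exists 1; rewrite addn0 mulr1.
  have [d Ed] := path_mul_path i j.+1 a (s i j) m.
  by exists (d * b); rewrite Em path_cat E Ed addnS addSn mulrA.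
have [N N0] := arrw_nilp G; have [b ->] := step N.
by rewrite path_cat N0 mulr0 mul0r.
Qed.

(** In other words a nonzero [p i j] lies outside p_{i,j+1}A, so that the
    coefficient of a leading term is well defined. *)
Lemma path_lead0 i j c a : c != 0 -> c *: p i j = p i j.+1 * a -> p i j = 0.
Proof.
move=> c0 E; apply: (@path_nakayama _ _ (c^-1 *: a)).
by rewrite -scalerAr -E scalerA mulVf // scale1r.
Qed.

(** Descending induction along p_{i,0}A >= p_{i,1}A >= ... >= 0. *)
Lemma generators_ind (P : A -> Prop) :
  (forall a b, P a -> P b -> P (a + b)) -> (forall c a, P a -> P (c *: a)) ->
  (forall a b, P a -> P b -> P (a * b)) ->
  (forall i, P (e i)) -> (forall i, P (x i)) -> forall a, P a.
Proof.
move=> PD PZ PM Pe Px a; have [N N0] := arrw_nilp G.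
have Pp i l : P (p i l).
  by elim: l i => [|l IHl] i /=; [apply: Pe | apply: PM].
have P0 : P 0.
  have [i _] : exists i : 'I_n, True.
    apply: contrapT => noI; have /eqP := @oner_neq0 A; apply.
    by rewrite -(idem_sum G) big1 // => i; case: noI; exists i.
  by rewrite -(scale0r (e i)); apply: PZ.
have Ppa d i b : (d <= N)%N -> P (p i (N - d)%N * b).
  elim: d b => [|d IHd] b dN; first by rewrite subn0 N0 mul0r.
  have [c [b' ->]] := path_split i (N - d.+1)%N b.
  by apply: PD; [apply: PZ | rewrite subnSK //; apply: IHd; apply: ltnW].
rewrite -[a]mul1r -(idem_sum G) mulr_suml.
apply: big_rec => // i b _ Pb; apply: PD => //.
by have := Ppa N i a (leqnn N); rewrite subnn.
Qed.

Lemma proj_spaceP (u v : A) : v \in proj_space u <-> exists a, v = u * a.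
Proof.
split=> [|[a ->]]; last by rewrite memv_mul ?memv_line ?memvf.
suff /subvP H : (proj_space u <= limg (amull u))%VS.
  by move=> /H /memv_imgP[a _ ->]; exists a; rewrite lfunE.
apply/prodvP => w b /vlineP[c ->] _; apply/memv_imgP; exists (c *: b); rewrite ?memvf //.
by rewrite lfunE /= -scalerAl -scalerAr.
Qed.

(** The two-sided ideal generated by the arrows: it is the sum of the x_iA,
    since the arrow [x i] is the only one that leaves [i]. *)
Definition in_arrow_ideal (a : A) : Prop := forall i, exists b, e i * a = x i * b.

Lemma arrow_ideal_mull a r : in_arrow_ideal r -> in_arrow_ideal (a * r).
Proof.
move=> Rr i; have [c [b E]] := idem_split G i a; have [d Ed] := Rr i.
exists (c *: d + b * r).
by rewrite mulrA E mulrDl -scalerAl Ed mulrDr -scalerAr mulrA.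
Qed.

Lemma arrow_ideal_nil r : in_arrow_ideal r -> exists N, r ^+ N = 0.
Proof.
move=> Rr; have [N N0] := arrw_nilp G; exists N.
have H l i : exists a, e i * r ^+ l = p i l * a.
  elim: l => [|l [a E]]; first by exists 1.
  have [b Eb] := arrow_ideal_mull a Rr (s i l).
  exists b; rewrite exprSr mulrA E -[LHS]mulrA -[p i l in LHS]path_tgt.
  by rewrite -[LHS]mulrA Eb [LHS]mulrA -path_rcons.
rewrite -[_ ^+ _]mul1r -(idem_sum G) mulr_suml big1 // => i _.
by have [a ->] := H N i; rewrite N0 mul0r.
Qed.

(** The arrow ideal is nilpotent, so it lies in every maximal right ideal m: if
    m + aA = A then 1 - ab is in m for some [b], but it is invertible.
    Conversely {a | e_i a in x_iA} is a maximal right ideal for every [i],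
    because its quotient is spanned by the class of e_i, and these ideals
    intersect in the arrow ideal. *)
Lemma in_jacobsonP a : a \in jacobson A <-> in_arrow_ideal a.
Proof.
split=> [/jacobsonP aJ i|Ra]; last first.
  apply/jacobsonP => m [rm m1 mmax]; apply: contrapT => am.
  have rV : right_ideal (m + proj_space a)%VS.
    by rewrite /right_ideal prodvDl addvS // proj_space_right_ideal.
  have aV : a \in (m + proj_space a)%VS.
    by apply: subvP (addvSr _ _) _ _; apply/proj_spaceP; exists 1; rewrite mulr1.
  case: (mmax _ rV (addvSl _ _)) => VE; first by rewrite VE in aV.
  have : 1 \in (m + proj_space a)%VS by rewrite VE memvf.
  case/memv_addP => u um [v /proj_spaceP[b ->]] E.
  have Rab : in_arrow_ideal (a * b).
    by move=> i; have [d Ed] := Ra i; exists (d * b); rewrite mulrA Ed mulrA.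
  have [N N0] := arrow_ideal_nil Rab.
  have : 1 \in m.
    have -> : 1 = u * \sum_(l < N) (a * b) ^+ l.
      have -> : u = 1 - a * b by rewrite E addrK.
      by rewrite -opprB mulNr -subrX1 N0 sub0r opprK.
    by apply: subvP rm _ _; apply: memv_mul; rewrite ?memvf.
  move=> m1'; apply: m1; apply/vspaceP => w; rewrite memvf.
  by rewrite -[w]mul1r; apply: subvP rm _ _; apply: memv_mul; rewrite ?memvf.
pose m := (amull (e i) @^-1: proj_space (x i))%VS.
have mP w : w \in m <-> exists b, e i * w = x i * b.
  by rewrite -memv_preim lfunE; apply: proj_spaceP.
apply/mP; apply: aJ; split.
- apply/prodvP => u v /mP[b E] _; apply/mP; exists (b * v).
  by rewrite !mulrA E.
- move=> mf; have /mP[b] : 1 \in m by rewrite mf memvf.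
  rewrite mulr1 => E; have /eqP := idem_neq0 G i; apply.
  by apply: (@path_nakayama i 0 (e (ordS i) * b)); rewrite /= mulrA arrw_tgt E arrw_tgt.
- move=> V rV mV; have [|] := pselect (V = m); [by left | right].
  have [/subvP Vm|/subvPn[v vV vm]] := boolP (V <= m)%VS.
    by case: b; apply/eqP; rewrite eqEsubv mV andbT; apply/subvP.
  have [c [d E]] := idem_split G i v.
  have c0 : c != 0.
    by apply: contraNneq vm => c0; apply/mP; exists d; rewrite E c0 scale0r add0r.
  have inV w : w \in m -> w \in V by apply: subvP.
  have evV : e i * v \in V.
    rewrite -[e i * v](subKr v) rpredB // inV //; apply/mP; exists 0.
    by rewrite mulrBr mulrA idem_orth eqxx subrr mulr0.
  have eV : e i \in V.
    have : c *: e i \in V.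
      rewrite -[c *: _](addrK (x i * d)) -E rpredB // inV //; apply/mP; exists d.
      by rewrite mulrA arrw_src.
    by rewrite rpredZeq (negPf c0).
  have oV : 1 \in V.
    rewrite -(subrK (e i) 1) rpredD // inV //; apply/mP; exists 0.
    by rewrite mulrBr mulr1 idem_orth eqxx subrr mulr0.
  apply/vspaceP => w; rewrite memvf.
  by rewrite -[w]mul1r; apply: subvP rV _ _; apply: memv_mul; rewrite ?memvf.
Qed.

Lemma arrow_in_jacobson i : x i \in jacobson A.
Proof.
apply/in_jacobsonP => j; have := path_arrow j 0 i; rewrite /= => ->.
by case: eqP => _; [exists (e (ordS j)) | exists 0; rewrite mulr0].
Qed.

(** Since e_aJ = x_aA, each further factor J extends the path by one arrow. *)
Lemma proj_rad_spaceE i k : proj_rad_space (e i) k = proj_space (p i k).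
Proof.
rewrite /proj_rad_space /jacobson_pow; elim: k => [|k IHk].
  by rewrite expv0 prodv1.
rewrite expvSr !prodvA -[(_ * _ * _ ^+ k)%VS]prodvA IHk.
apply/eqP; rewrite eqEsubv; apply/andP; split.
  apply/prodvP => u v /proj_spaceP[a ->] /in_jacobsonP vJ.
  have [b E] := arrow_ideal_mull a vJ (s i k); apply/proj_spaceP; exists b.
  rewrite -[LHS]mulrA -[p i k in LHS]path_tgt.
  by rewrite -[LHS]mulrA E [LHS]mulrA -path_rcons.
apply/subvP => w /proj_spaceP[a ->].
rewrite path_rcons -mulrA; apply: memv_mul.
  by apply/proj_spaceP; exists 1; rewrite mulr1.
apply: subvP (@jacobson_right_ideal _ A) _ _.
by apply: memv_mul; [apply: arrow_in_jacobson | apply: memvf].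
Qed.

Lemma dim_proj_space_path i k : p i k != 0 ->
  \dim (proj_space (p i k)) = (\dim (proj_space (p i k.+1))).+1.
Proof.
move=> pk0; have [pS pN] : p i k.+1 \in proj_space (p i k) /\
    p i k \notin proj_space (p i k.+1).
  split; first by apply/proj_spaceP; exists (x (s i k)); rewrite path_rcons.
  by apply: contraNN pk0 => /proj_spaceP[a /path_nakayama ->].
have -> : proj_space (p i k) = (<[p i k]> + proj_space (p i k.+1))%VS.
  apply/eqP; rewrite eqEsubv subv_add -memvE; apply/and3P; split.
  - apply/subvP => _ /proj_spaceP[a ->]; have [c [b ->]] := path_split i k a.
    by apply: memv_add; [rewrite memvZ ?memv_line | apply/proj_spaceP; exists b].
  - by apply/proj_spaceP; exists 1; rewrite mulr1.
  - apply/subvP => _ /proj_spaceP[a ->]; apply/proj_spaceP.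
    by exists (x (s i k) * a); rewrite mulrA -path_rcons.
rewrite dimv_disjoint_sum ?dim_vline ?pk0 //; apply/eqP; rewrite -subv0.
apply/subvP => w /memv_capP[/vlineP[c ->]]; rewrite memv0 => cS.
by move: cS; rewrite rpredZeq (negPf pN) orbF => /eqP ->; rewrite scale0r.
Qed.

(** The nonzero [p i l] form a basis of e_iA, so c_i is the length of the
    longest nonzero path from [i] plus one. *)
Lemma path_eq0 i k : (p i k == 0) = (\dim (proj_space (e i)) <= k)%N.
Proof.
have dimE l : (forall j, (j < l)%N -> p i j != 0) ->
    \dim (proj_space (e i)) = (l + \dim (proj_space (p i l)))%N.
  elim: l => [|l IHl] pl //; rewrite IHl => [|j jl]; last by rewrite pl // ltnW.
  by rewrite dim_proj_space_path ?pl // addSnnS.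
apply/idP/idP => [pk|]; last first.
  apply: contraTT => pk; rewrite -ltnNge (dimE k.+1) ?leq_addr // => j jk.
  by apply: contraNneq pk => pj; apply/eqP; apply: (@path_eq0_le i j k jk pj).
have [l /eqP pl lmin] := ex_minnP (ex_intro (fun l => p i l == 0) k pk).
rewrite (dimE l) => [|j jl].
  have -> : proj_space (p i l) = 0%VS by rewrite pl /proj_space prod0v.
  by rewrite dimv0 addn0 lmin.
by apply/negP => /lmin; rewrite leqNgt jl.
Qed.

End Paths.

(** * Uniserial modules *)

Section SerialModules.
Variables (K : fieldType) (A : falgType K) (n : nat).
Variable G : serial_generators A n.
Implicit Types (M N X Y : rmodule A).
Notation e := (idem G).
Notation x := (arrw G).
Notation p := (arrow_path (idem G) (arrw G)).
Notation s := (fun i l => iter l (@ordS n) i).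

(** [M] is e_iA/e_iJ^k with generator [g].  Stating this through [g] makes the
    arguments independent of the complement on which [proj_quot] is carried. *)
Definition serial_on M (i : 'I_n) (k : nat) (g : M) : Prop :=
  [/\ act g (e i) = g, forall w, exists a, w = act g a &
      forall a, act g a = 0 <-> exists b, e i * a = p i k * b].

Lemma proj_quot_serial i k : exists g : proj_quot (e i) k, serial_on i k g.
Proof.
set M := proj_quot (e i) k.
have [pl pa ps p0] := @subquot_projP _ _ (regular_mod A) _ _
  (right_ideal_act (proj_space_right_ideal (e i)))
  (right_ideal_act (proj_rad_space_right_ideal (e i) k)).
pose pi : A -> M := @subquot_proj _ _ (regular_mod A) (proj_space (e i)) (proj_rad_space (e i) k).
have eU a : e i * a \in proj_space (e i) by apply/proj_spaceP; exists a.
have eU1 : e i \in proj_space (e i) by have := eU 1; rewrite mulr1.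
have piM a : act (pi (e i)) a = pi (e i * a) by symmetry; apply: (pa _ a eU1).
exists (pi (e i)); split.
- by rewrite piM idem_orth eqxx.
- move=> w; have [v /proj_spaceP[a ->] <-] := ps w.
  by exists a; rewrite piM.
- move=> a; rewrite piM; split.
    by move/(p0 _ (eU a)); rewrite proj_rad_spaceE => /proj_spaceP.
  by move=> H; apply/(p0 _ (eU a)); rewrite proj_rad_spaceE; apply/proj_spaceP.
Qed.

Section OneModule.
Variables (M : rmodule A) (i : 'I_n) (k : nat) (g : M).
Hypothesis Mg : serial_on i k g.

Lemma serial_path_kill a : act g (p i k * a) = 0.
Proof.
have [_ _ H] := Mg; apply/H; exists a.
by rewrite mulrA path_src.
Qed.

Lemma serial_annihilator (w : M) b : act w (p b k) = 0.
Proof.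
have [ge gs _] := Mg; have [a ->] := gs w.
rewrite -ge -!actM; have [d] := path_mul_path G i 0 a b k.
by rewrite /= mulrA => ->; apply: serial_path_kill.
Qed.

Lemma serial_path_eq0 j : act g (p i j) = 0 -> (j < k)%N -> p i j = 0.
Proof.
have [_ _ H] := Mg; move=> /H[b]; rewrite path_src => E jk.
have [d Ed] := path_le G i jk; apply: (@path_nakayama _ _ _ G i j (d * b)).
by rewrite E Ed mulrA.
Qed.

Lemma serial_universal N (z : N) : act z (e i) = z -> act z (p i k) = 0 ->
  exists2 f : 'Hom(M, N), mod_hom f & forall a, f (act g a) = act z a.
Proof.
have [ge gs H] := Mg; move=> ze zp.
have [c cE] := choice gs.
have wd a b : act g a = act g b -> act z a = act z b.
  move=> E; apply/eqP; rewrite -subr_eq0 -actBr -ze -actM.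
  have /H[d ->] : act g (a - b) = 0 by rewrite actBr E subrr.
  by rewrite actM zp act0l.
have fE a : act z (c (act g a)) = act z a by apply: wd; rewrite -cE.
have [F hF FE] : exists2 F : 'Hom(M, N), mod_hom F & F =1 (fun w => act z (c w)).
  apply: mod_hom_of_linear => [t u v|v a].
    by rewrite -actZr -actDr; apply: wd; rewrite -cE actDr actZr -!cE.
  by rewrite -actM; apply: wd; rewrite -cE actM -cE.
by exists F => // a; rewrite FE fE.
Qed.

(** If [w] has leading term p_{i,j}, the path of length k-1-j from its end
    sends the leading term to p_{i,k-1} and all later terms to p_{i,k}A.  The
    last clause holds since right multiplication by e_d kills the leading term
    unless [d] is its end vertex. *)
Lemma serial_socle (w : M) : w <> 0 -> exists j c,
  [/\ (j < k)%N, c != 0,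
      act w (p (s i j) (k - j.+1)) = c *: act g (p i k.-1) &
      forall d, act w (e d) = w -> d = s i j].
Proof.
have [ge gs H] := Mg; have [a0 E0] := gs w => w0.
have E : w = act g (e i * a0) by rewrite actM ge.
have [|[a Ea]|[j [c [b [jk c0 Eb]]]]] := @leading_term _ _ _ G i k (e i * a0).
- by rewrite mulrA idem_orth eqxx.
- by case: w0; rewrite E Ea serial_path_kill.
exists j, c; split=> // [|d].
  rewrite E Eb -actM mulrDl -scalerAl path_mul eqxx.
  have [b' ->] := path_mul_path G i j.+1 b (s i j) (k - j.+1).
  have -> : (j.+1 + (k - j.+1) = k)%N by rewrite subnKC.
  have -> : (j + (k - j.+1) = k.-1)%N by rewrite -subn1 -{2}(subnKC jk) addSn subn1.
  by rewrite actDr actZr serial_path_kill addr0.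
move=> wd; apply/eqP/negP => /negP dj; apply: w0.
have E' : w = act g (p i j.+1 * (b * e d)).
  have pd : p i j * e d = 0 by have := path_mul G i j d 0; rewrite (negPf dj).
  by rewrite -wd {1}E Eb -actM mulrDl -scalerAl pd scaler0 add0r mulrA.
have : act g (c *: p i j + p i j.+1 * (b - b * e d)) = 0.
  by rewrite mulrBr addrA -Eb actBr -E -E' subrr.
case/H => d1; rewrite mulrDr -scalerAr mulrA !path_src => E1.
have pj0 : p i j = 0.
  have [d2 Ed2] := path_le G i jk.
  apply: (@path_lead0 _ _ _ G i j c (d2 * d1 - (b - b * e d)) c0).
  by rewrite mulrBr mulrA -Ed2 -E1 addrK.
by rewrite E' path_rcons pj0 !mul0r act0r.
Qed.

(** The socle of a uniserial module is simple, so it suffices to test a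
    homomorphism there. *)
Lemma serial_hom_inj N (f : 'Hom(M, N)) : mod_hom f ->
  f (act g (p i k.-1)) <> 0 -> injective f.
Proof.
move=> hf f0 u v E; apply/eqP; rewrite -subr_eq0; apply/eqP; apply: contrapT.
move=> uv; have [j [c [jk c0 Ej _]]] := serial_socle uv; apply: f0.
apply/eqP; have := congr1 f Ej; rewrite hf linearB /= E subrr act0l linearZ /= => /esym/eqP.
by rewrite scaler_eq0 (negPf c0).
Qed.

End OneModule.
End SerialModules.

(** * Rigidity, and the classification of indecomposables *)

Section Rigidity.
Variables (K : fieldType) (A : falgType K) (n : nat).
Variable G : serial_generators A n.
Implicit Types (M N X Y : rmodule A).
Notation e := (idem G).
Notation x := (arrw G).
Notation p := (arrow_path (idem G) (arrw G)).
Notation s := (fun i l => iter l (@ordS n) i).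

(** For c = c_i the homomorphisms e_iJ^k -> M correspond to the [w] satisfying
    the two equations, so this says that only zero occurs.  A nonzero
    [w] would have a leading term p_{i,j} with j <= k - n, which contradicts
    k < n; and if c < k + n, the path from [w] to the socle would factor through
    [p (i+k) (c-k)], which kills [w]. *)
Lemma syzygy_image_eq0 M i k (g : M) c (w : M) :
  serial_on G i k g -> (0 < k <= c)%N -> p i k.-1 <> 0 ->
  (k < n)%N \/ (c < k + n)%N ->
  act w (e (s i k)) = w -> act w (p (s i k) (c - k)) = 0 -> w = 0.
Proof.
move=> Mg /andP[k0 kc] pk short we wp; apply: contrapT => /(serial_socle Mg).
case=> j [d [jk d0 E /(_ _ we) sE]].
have nkj : (n <= k - j)%N.
  apply: dvdn_leq; first by rewrite subn_gt0.
  have /eqP : ((i + k) %% n = (i + j) %% n)%N.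
    by rewrite -(val_shift i k) -(val_shift i j) sE.
  by rewrite eqn_modDl eqn_mod_dvd // ltnW.
have ck : (c - k <= k - j.+1)%N by case: short; lia.
have {}E : d *: act g (p i k.-1) = 0.
  by rewrite -E -sE -(subnKC ck) path_cat actM wp act0l.
apply: pk; apply: (serial_path_eq0 Mg); last by rewrite prednK.
by move/eqP: E; rewrite scaler_eq0 (negPf d0) => /eqP.
Qed.

(** An extension of X by Y splits when each generator of M^m, sent to X by the
    retraction, lifts to an element killed by [p i k].  A lift [z] has
    z p_{i,k} = y in Y, and [syzygy_image_eq0] applies to the components of
    [y] in the power of M that contains Y. *)
Lemma serial_rigid M i k (g : M) c : serial_on G i k g -> (0 < k <= c)%N ->
  p i c = 0 -> p i k.-1 <> 0 -> (k < n)%N \/ (c < k + n)%N -> rigid1 M.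
Proof.
move=> Mg kc pc pk short X Y [m _ /direct_summandP[f [h [hf hh fK]]]].
case=> [q _ /direct_summandP[f' [h' [hf' _ fK']]]] E.
have [ge gs _] := Mg.
set inc := ext_inc E; set prj := ext_prj E.
have hinc : mod_hom inc := @ext_inc_hom _ _ _ _ E.
have hprj : mod_hom prj := @ext_prj_hom _ _ _ _ E.
pose u (t : 'I_m) (w : M) : mpow M m := [ffun t' => if t' == t then w else 0].
have uact t w a : act (u t w) a = u t (act w a).
  by apply/ffunP => t'; rewrite !ffunE; case: ifP => // _; rewrite act0l.
have lift t : exists z : ext_mid E,
    [/\ prj z = h (u t g), act z (e i) = z & act z (p i k) = 0].
  have /memv_imgP[z0 _ z0E] : h (u t g) \in limg prj by rewrite (ext_prj_surj E) memvf.
  pose z := act z0 (e i).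
  have ze : act z (e i) = z by rewrite -actM idem_orth eqxx.
  have zE : prj z = h (u t g) by rewrite hprj -z0E -hh uact ge.
  exists z; split=> //.
  have /memv_imgP[y0 _ y0E] : act z (p i k) \in limg inc.
    rewrite (ext_exact E) memv_ker hprj zE -hh uact.
    have -> : act g (p i k) = 0 by rewrite -[p i k]mulr1 (serial_path_kill Mg).
    have -> : u t 0 = 0 by apply/ffunP => t'; rewrite !ffunE if_same.
    by rewrite linear0.
  pose y := act y0 (e (s i k)).
  have yE : act z (p i k) = inc y by rewrite hinc -y0E -actM path_tgt.
  have inc0 v : inc v = 0 -> v = 0.
    move=> v0; apply/eqP; rewrite -memv0 -(ext_inc_inj E) memv_ker.
    exact/eqP.
  suff f'y : f' y = 0.
    have yz : y = 0 by rewrite -(fK' y) f'y linear0.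
    by rewrite yE yz linear0.
  have ye : act y (e (s i k)) = y by rewrite -actM idem_orth eqxx.
  have yp : act y (p (s i k) (c - k)) = 0.
    apply: inc0; rewrite hinc -yE -actM -path_cat subnKC; last by case/andP: kc.
    by rewrite pc act0r.
  apply/ffunP => t'; rewrite [RHS]ffunE.
  apply: (syzygy_image_eq0 Mg kc pk short).
    by have := congr1 (fun v : mpow M q => v t') (hf' y (e (s i k))); rewrite ye ffunE.
  have := congr1 (fun v : mpow M q => v t') (hf' y (p (s i k) (c - k))).
  by rewrite yp linear0 !ffunE.
have [z zP] := choice lift.
have liftM t : exists F : 'Hom(M, ext_mid E),
    mod_hom F /\ forall a, F (act g a) = act (z t) a.
  have [_ ze zp] := zP t.
  by have [F hF FE] := serial_universal Mg ze zp; exists F.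
have [F FP] := choice liftM.
have [S hS SE] : exists2 S : 'Hom(X, ext_mid E),
    mod_hom S & S =1 (fun v => \sum_t F t ((f v : mpow M m) t)).
  apply: mod_hom_of_linear => [a v w|v a].
    rewrite scaler_sumr -big_split; apply: eq_bigr => t _ /=.
    by rewrite linearP !ffunE linearP.
  rewrite act_suml; apply: eq_bigr => t _.
  by rewrite hf ffunE (FP t).1.
apply: (@ext_split _ _ X Y E S hS) => v.
rewrite SE linear_sum -[RHS]fK.
have -> : f v = \sum_t u t ((f v : mpow M m) t).
  apply/ffunP => t; rewrite sum_ffunE (bigD1 t) //= big1 => [|t' nt]; rewrite ffunE.
    by rewrite eqxx addr0.
  by rewrite eq_sym (negPf nt).
rewrite linear_sum; apply: eq_bigr => t _.
have -> : (\sum_t0 u t0 ((f v : mpow M m) t0)) t = (f v : mpow M m) t.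
  rewrite sum_ffunE (bigD1 t) //= big1 => [|t' nt]; rewrite ffunE.
    by rewrite eqxx addr0.
  by rewrite eq_sym (negPf nt).
have [a ->] := gs ((f v : mpow M m) t).
have [zE _ _] := zP t.
by rewrite (FP t).2; apply: etrans (hprj _ _) _; rewrite zE -hh uact.
Qed.

(** The nonsplit sequence sends 1 to (p_{i,n}, 1) and then (a, b) to
    a - p_{i,n} b; here p_{i,n} ends at [i]. *)
Lemma serial_not_rigid M i k (g : M) : serial_on G i k g -> (0 < n <= k)%N ->
  p i (k + n).-1 <> 0 -> ~ rigid1 M.
Proof.
move=> Mg /andP[n0 nk] pkn rM; have [ge gs H] := Mg.
have pnk l : p i (n + l) = p i n * p i l by rewrite path_cat shift_n.
have serial_ex l : exists (N : rmodule A) (h : N), serial_on G i l h.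
  by have [h Nh] := proj_quot_serial G i l; exists (proj_quot (e i) l), h.
have [E1 [g1 Q1]] := serial_ex (k + n)%N; have [E2 [g2 Q2]] := serial_ex (k - n)%N.
have [g1e g1s _] := Q1; have [g2e g2s _] := Q2.
have kill (N : rmodule A) l (h : N) : serial_on G i l h ->
    forall m b, (l <= m)%N -> act h (p i m * b) = 0.
  move=> Nh m b /(path_le G i)[d ->]; rewrite -mulrA; exact: serial_path_kill Nh _.
have pne : p i n * e i = p i n by rewrite -{2}(shift_n i) path_tgt.
have [inc hinc incE] : exists2 F : 'Hom(M, dsum E1 E2), mod_hom F &
    forall a, F (act g a) = (act g1 (p i n * a), act g2 a).
  have ze : act ((act g1 (p i n), g2) : dsum E1 E2) (e i) = (act g1 (p i n), g2).
    by congr pair => //; rewrite -actM pne.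
  have zp : act ((act g1 (p i n), g2) : dsum E1 E2) (p i k) = 0.
    congr pair => /=.
      by rewrite -actM -pnk addnC -[p _ _]mulr1 (kill _ _ _ Q1).
    by rewrite -[p _ _]mulr1 (kill _ _ _ Q2) // leq_subr.
  have [F hF FE] := serial_universal Mg ze zp; exists F => // a.
  by rewrite FE; congr pair; rewrite -actM.
have [al hal alE] : exists2 F : 'Hom(E1, M), mod_hom F & forall a, F (act g1 a) = act g a.
  by apply: (serial_universal Q1) => //; rewrite -[p _ _]mulr1 (kill _ _ _ Mg) // leq_addr.
have [be hbe beE] : exists2 F : 'Hom(E2, M), mod_hom F &
    forall a, F (act g2 a) = act g (p i n * a).
  have [||F hF FE] := @serial_universal _ _ _ _ _ _ _ _ Q2 _ (act g (p i n)).
  - by rewrite -actM pne.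
  - by rewrite -actM -pnk subnKC // -[p _ _]mulr1 (kill _ _ _ Mg).
  by exists F => // a; rewrite FE actM.
have [prj hprj prjE] : exists2 F : 'Hom(dsum E1 E2, M), mod_hom F &
    F =1 (fun v => al v.1 - be v.2).
  apply: mod_hom_of_linear => [a u v|v a] /=.
    by rewrite (linearP al) (linearP be) scalerBr opprD addrACA.
  by rewrite hal hbe actBl.
have incI : lker inc = 0%VS.
  apply/eqP/lker0P; apply: (serial_hom_inj Mg hinc).
  have k0 : (0 < k)%N by apply: leq_trans nk.
  rewrite incE => -[Z1 _]; apply: pkn; apply: (serial_path_eq0 Q1); last first.
    by rewrite prednK // addn_gt0 k0.
  have -> : ((k + n).-1 = n + k.-1)%N by lia.
  by rewrite pnk.
have exact : limg inc = lker prj.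
  apply/vspaceP => v; apply/memv_imgP/idP => [[w _ ->]|].
    have [a ->] := gs w; rewrite memv_ker prjE incE /= alE beE.
    by rewrite subrr.
  case: v => v1 v2; rewrite memv_ker prjE /=.
  have [a ->] := g1s v1; have [b ->] := g2s v2.
  rewrite alE beE -actBr => /eqP/H[d]; rewrite mulrBr [e i * (p i n * b)]mulrA path_src.
  rewrite -{1}(subnKC nk) pnk => /(canRL (subrK _)) Ea.
  exists (act g (p i (k - n) * d + b)); first exact: memvf.
  rewrite incE; congr pair.
    by rewrite mulrDr [p i n * (_ * _)]mulrA -Ea actM g1e.
  by rewrite actDr (kill _ _ _ Q2) // add0r.
have surj : limg prj = fullv.
  apply/vspaceP => w; rewrite memvf; apply/memv_imgP; have [a ->] := gs w.
  by exists ((act g1 a, 0) : dsum E1 E2); rewrite ?memvf // prjE /= alE linear0 subr0.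
have [h [hh [h' hK _] _ _]] := rM _ _ (add_closure_refl M) (add_closure_refl M)
  (Extension hinc hprj incI exact surj).
have : act ((g1, 0) : dsum E1 E2) (p i k) = 0.
  apply: (can_inj hK); apply: etrans (hh _ _) _; rewrite linear0.
  by congr pair; apply: (serial_annihilator Mg).
case=> /(serial_path_eq0 Q1) pk _; apply: pkn.
apply: (@path_eq0_le _ _ _ G i k); last by apply: pk; rewrite -[X in (X < _)%N]addn0 ltn_add2l.
by rewrite -subn1 -addnBA // leq_addr.
Qed.

Lemma functional_at (V : vectType K) (v : V) : v != 0 ->
  exists2 phi : V -> K, linear (phi : V -> K^o) & phi v = 1.
Proof.
move=> v0; exists (coord [tuple v] 0); first by move=> k a b; rewrite linearP.
by have := @coord_free _ _ _ [tuple v] 0 0; apply; rewrite seq1_free.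
Qed.

(** Among the modules killed by J^{k+1}, the uniserial module [Q] of length k+1
    is injective, and it embeds by g |-> m.  The proof is explicit: a linear
    form [phi] with value 1 at m p_{i,k} induces the homomorphism [r] from
    [M] to [Q] whose coordinate at p_{i,j} is the value of [phi] after
    multiplication by the path that leads from p_{i,j} to the socle; [r] does
    not vanish on the socle of mA. *)
Lemma serial_retraction M (Q : rmodule A) i k (g : Q) (m : M) : serial_on G i k.+1 g ->
  (forall b v, act v (p b k.+1) = 0 :> M) ->
  act m (p i k) <> 0 -> act m (e i) = m -> retract Q M.
Proof.
move=> Qg kill mp me.
have [f hf fE] := serial_universal Qg me (kill i m).
have /functional_at[phi phil phim] : act m (p i k) != 0 by apply/eqP.
have phi0 : phi 0 = 0.
  by have := phil (-1) 0 0; rewrite scaler0 addr0 => ->; rewrite scaleN1r addNr.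
have killm b l v a : (k < l)%N -> act v (p b l * a) = 0 :> M.
  by move=> /(path_le G b)[d ->]; rewrite -mulrA actM kill act0l.
pose r (v : M) : Q :=
  \sum_(j < k.+1) phi (act v (p (s i j) (k - j))) *: act g (p i j).
have rl : linear r.
  move=> t u v; rewrite /r scaler_sumr -big_split; apply: eq_bigr => j _ /=.
  by rewrite actDl actZl phil scalerDl scalerA.
have r0 : r 0 = 0 by have := rl (-1) 0 0; rewrite scaler0 addr0 => ->; rewrite scaleN1r addNr.
have ract a : forall v, r (act v a) = act (r v) a.
  move: a; apply: (@generators_ind _ _ _ G (fun a => forall v, r (act v a) = act (r v) a))
    => [a b Ha Hb|c a Ha|a b Ha Hb|b|b] v.
  - by rewrite !actDr -Ha -Hb; have := rl 1 (act v a) (act v b); rewrite !scale1r.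
  - by rewrite !actZr -Ha; have := rl c (act v a) 0; rewrite r0 !addr0.
  - by rewrite !actM Hb Ha.
  - rewrite act_suml; apply: eq_bigr => j _; rewrite -actM actZl -actM.
    have := path_mul G b 0 (s i j) (k - j); have := path_mul G i j b 0.
    rewrite /= addn0 add0n [s i j == b]eq_sym => -> ->.
    by case: eqP => [->|_] //; rewrite !act0r phi0 scale0r scaler0.
  (* Multiplication by an arrow shifts the index: the first term on the left
     and the last on the right contain paths of length k+1, which vanish. *)
  - rewrite act_suml [RHS]big_ord_recr [LHS]big_ord_recl /=.
    have -> : act v (x b) = act v (p b 1) by rewrite /= arrw_tgt.
    rewrite -actM path_mul subn0.
    have -> : act v (if i == s b 1 then p b (1 + k) else 0) = 0.
      by case: eqP => _; rewrite ?act0r // -[p _ _]mulr1 killm.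
    rewrite phi0 scale0r add0r actZl -actM path_arrow.
    have -> : act g (if b == s i k then p i k.+1 else 0) = 0.
      by case: eqP => _; rewrite ?act0r // -[p _ _]mulr1 (serial_path_kill Qg).
    rewrite scaler0 addr0; apply: eq_bigr => j _.
    rewrite -actM path_mul actZl -actM path_arrow /bump leq0n !add1n.
    rewrite iterS (can_eq (@ordSK n)) [_ == b]eq_sym.
    case: eqP => [->|_]; last by rewrite !act0r phi0 scale0r scaler0.
    by rewrite subnSK.
have [R hR RE] := mod_hom_of_linear rl (fun v a => ract a v).
apply: (retract_of_inj_endo hf hR).
have hRf : mod_hom (R \o f)%VF by apply: mod_hom_comp.
have RfI : injective (R \o f)%VF.
  apply: (serial_hom_inj Qg hRf); rewrite comp_lfunE RE fE /r.
  rewrite (bigD1 ord_max) //= subnn -actM path_tgt phim scale1r big1 ?addr0.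
    move=> /(serial_path_eq0 Qg) pk; apply: mp.
    by rewrite pk ?act0r.
  move=> j; rewrite -val_eqE /= => jk; have jlt := ltn_ord j.
  rewrite -actM path_mul; case: eqP => _; last by rewrite act0r phi0 scale0r.
  by rewrite -[p _ _]mulr1 killm ?phi0 ?scale0r //; lia.
by move=> u v /= E; apply: RfI; rewrite !comp_lfunE.
Qed.

(** The length of the uniserial summand is the Loewy length of [M], and its
    generator is any m = m e_i that some path of maximal length does not kill. *)
Lemma indecomposable_serial M : indecomposable M -> exists i k,
  [/\ (0 < k)%N, p i k.-1 <> 0 & mod_iso M (proj_quot (e i) k)].
Proof.
move=> indM; have [nz _] := indM; have [N N0] := arrw_nilp G.
have exk : exists k, `[< forall b (v : M), act v (p b k) = 0 >].
  by exists N; apply/asboolP => b v; rewrite N0 act0r.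
have [[|k] /asboolP kill kmin] := ex_minnP exk.
  case: nz; apply/zero_modP => v.
  by rewrite -(act1 v) -(idem_sum G) act_sumr big1 // => b _; apply: (kill b).
have [i [v0 vp]] : exists i, exists v : M, act v (p i k) <> 0.
  apply: contrapT => no.
  suff /asboolP/kmin : forall b (v : M), act v (p b k) = 0 by rewrite ltnn.
  by move=> b v; apply: contrapT => vp; apply: no; exists b, v.
have retr : retract (proj_quot (e i) k.+1) M.
  have [g Qg] := proj_quot_serial G i k.+1.
  apply: (@serial_retraction M _ i k g (act v0 (e i))) => //.
    by rewrite -actM path_src.
  by rewrite -actM idem_orth eqxx.
have pk : p i k <> 0 by move=> pk; apply: vp; rewrite pk act0r.
exists i, k.+1; split=> //; apply: indecomposable_retract indM _ retr.
move/zero_modP => z; have [g Q] := proj_quot_serial G i k.+1.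
by apply: pk; apply: (serial_path_eq0 Q).
Qed.

End Rigidity.

(** * Counting isomorphism classes *)

Section Counting.
Variables (K : fieldType) (A : falgType K).

(** The representatives are first chosen in the finite index type, where [pick]
    gives the same answer on equivalent predicates, and then replaced by
    isomorphic modules for which [P] itself is known. *)
Lemma num_iso_classes_le (P : rmodule A -> Prop) (T : finType)
    (F : T -> rmodule A) :
  (forall M, P M -> exists t, mod_iso M (F t)) ->
  enat_le (num_iso_classes P) (Some #|T|).
Proof.
move=> cover; rewrite /num_iso_classes; case: pselect => [h|]; last first.
  case; pose isoT (t t' : T) := `[< mod_iso (F t) (F t') >].
  pose r t := odflt t [pick t' | isoT t t'].
  have rP t : mod_iso (F t) (F (r t)).
    by rewrite /r; case: pickP => [t' /asboolP|_] //; apply: mod_iso_refl.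
  have r_iso t t' : mod_iso (F t) (F t') -> r t = r t'.
    move=> tt'; rewrite /r; have E : isoT t =1 isoT t'.
      move=> u; apply/asboolP/asboolP; last exact: mod_iso_trans.
      exact: mod_iso_trans (mod_iso_sym tt').
    rewrite (eq_pick E); case: pickP => // /(_ t') /asboolP; case.
    exact: mod_iso_refl.
  pose S := [set r t | t in [pred t | `[< exists2 M, P M & mod_iso M (F t) >]]].
  have /choice[f fP] (i : 'I_#|S|) : exists M, P M /\ mod_iso M (F (enum_val i)).
    have /imsetP[t /asboolP[M PM Mt] ->] := enum_valP i.
    by exists M; split=> //; apply: mod_iso_trans Mt (rP t).
  have rS (i : 'I_#|S|) : r (enum_val i) = enum_val i.
    have /imsetP[t _ ->] := enum_valP i; symmetry; exact/r_iso/rP.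
  exists #|S|, f; split=> [i|i j ij|M PM]; first by case: (fP i).
    apply: enum_val_inj; rewrite -rS -[RHS]rS; apply: r_iso.
    apply: mod_iso_trans (mod_iso_sym (fP i).2) _.
    exact: mod_iso_trans ij (fP j).2.
  have [t Mt] := cover M PM.
  have tS : r t \in S by apply: imset_f; apply/asboolP; exists M.
  exists (enum_rank_in tS (r t)); apply: mod_iso_trans Mt _.
  apply: mod_iso_trans (rP t) (mod_iso_sym _).
  by have [_] := fP (enum_rank_in tS (r t)); rewrite enum_rankK_in.
case: cid => /= m [f [Pf f_inj _]].
have /choice[g gP] (i : 'I_m) : exists t, mod_iso (f i) (F t) by apply: cover.
rewrite -[m]card_ord; apply: (@leq_card _ _ g) => i j gij.
apply: f_inj; apply: mod_iso_trans (gP i) _; rewrite gij.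
exact/mod_iso_sym.
Qed.

End Counting.

(** * Presentations by the line and by the circle *)

Section Presentation.
Variables (K : fieldType) (A : falgType K) (n : nat) (Q : quiver 'I_n).
Hypothesis (src_inj : injective (@src _ Q)).
Hypothesis (tgtE : forall b : arrow Q, tgt b = ordS (src b)).

(** A path that starts at [v] is e_v or begins with the only arrow at [v], so
    e_vA is spanned by e_v modulo x_vA. *)
Lemma presentation_generators (P : bound_quiver_presentation A Q) :
  exists G : serial_generators A n, idem G = vtx P.
Proof.
pose e := vtx P; pose x i := \sum_(b | src b == i) arr P b.
have xE b : x (src b) = arr P b.
  rewrite /x (bigD1 b) //= big1 ?addr0 // => b' /andP[/eqP/src_inj -> ].
  by rewrite eqxx.
have xsrc i : e i * x i = x i.
  by rewrite mulr_sumr; apply: eq_bigr => b /eqP <-; rewrite /e vtx_src.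
have xtgt i : x i * e (ordS i) = x i.
  by rewrite mulr_suml; apply: eq_bigr => b /eqP <-; rewrite /e -tgtE vtx_tgt.
have e0 i : e i != 0.
  apply/eqP => ei0; pose q : qpath Q := exist _ (i, [::]) isT.
  have := @relations_sub_R2 _ _ _ _ P [:: q] (fun=> 1) isT.
  rewrite big_seq1 /qeval /= big_nil mulr1 scale1r => /(_ ei0 q).
  by rewrite mem_head => /(_ isT isT)/eqP; rewrite oner_eq0.
have split_e i a : exists c b, e i * a = c *: e i + x i * b.
  have [l [c ->]] := presentation_surj P a.
  elim: l => [|q l [d [b E]]]; first by exists 0, 0; rewrite big_nil !mulr0 scale0r addr0.
  rewrite big_cons mulrDr E -scalerAr /qeval mulrA /e vtx_orth.
  case: q => [[v t] /= tp]; case: eqP => [iv|_]; last first.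
    by exists d, b; rewrite mul0r scaler0 add0r.
  subst v; move: (c _) => cq; case: t tp => [_|b' t /= /andP[/eqP b'i _]].
    by exists (cq + d), b; rewrite big_nil mulr1 scalerDl addrA.
  exists d, (cq *: \prod_(b <- t) arr P b + b).
  by rewrite big_cons -b'i xE mulrA vtx_src mulrDr scalerAr addrCA.
have nil : exists N, forall i, arrow_path e x i N = 0.
  have [N _ N0] := Rm_sub_relations P; exists N => i.
  have pathE l j : arrow_path e x j l = 0 \/
      exists t, [/\ is_qpath j t, size t = l &
        arrow_path e x j l = e j * \prod_(b <- t) arr P b].
    elim: l j => [|l IHl] j /=.
      by right; exists [::]; rewrite big_nil mulr1.
    have [[b /eqP bj]|nob] := pselect (exists b : arrow Q, src b == j); last first.
      left; rewrite /x big1 ?mul0r // => b bj; by case: nob; exists b.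
    have [->|[t [tp <- ->]]] := IHl (ordS j); first by left; rewrite mulr0.
    right; exists (b :: t); split=> //=; first by rewrite bj eqxx tgtE bj.
    by rewrite big_cons mulrA xtgt -bj xE mulrA /e vtx_src.
  have [//|[t [tp tN ->]]] := pathE N i.
  have := N0 (exist _ (i, t) tp); rewrite /qlength /= tN leqnn; exact.
by exists (SerialGenerators (vtx_orth P) (vtx_sum P) xsrc xtgt e0 split_e nil).
Qed.

End Presentation.

(** * Rigid indecomposables of a Nakayama algebra *)

Theorem proposition2p10 (K : fieldType) (A : falgType K) (n : nat)
    (Q : quiver 'I_n) (P : bound_quiver_presentation A Q) :
  (2 <= n)%N ->
  Q = directed_line n \/ Q = directed_circle n ->
  nakayama_algebra A ->
  connected_algebra A ->
  ~ semisimple_algebra A ->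
  [/\ forall (i : 'I_n) (k : nat), (1 <= k <= kupisch P i)%N ->
        (rigid1 (proj_quot (vtx P i) k) <->
         (1 <= k <= n - 1)%N \/ ((kupisch P i)%:Z - n%:Z < k%:Z)%R),
      enat_le
        (num_iso_classes (fun M : rmodule A => indecomposable M /\ rigid1 M))
        (Some (n * (n - 1) + n ^ 2)%N)
    & enat_le (o1 A) (Some (n * (n - 1) + n ^ 2)%N)].
Proof.
move=> n2 QE _ _ _.
have [G GE] : exists G : serial_generators A n, idem G = vtx P.
  apply: presentation_generators; case: QE => -> //=.
  by move=> b b' /(congr1 val) /= bb'; apply: val_inj.
have p0 i k : (arrow_path (idem G) (arrw G) i k == 0) = (kupisch P i <= k)%N.
  by rewrite path_eq0 /kupisch GE.
have rigidP i k : (1 <= k <= kupisch P i)%N -> rigid1 (proj_quot (vtx P i) k) <->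
    (1 <= k <= n - 1)%N \/ ((kupisch P i)%:Z - n%:Z < k%:Z)%R.
  move=> kc; have /andP[k1 kc'] := kc.
  have [g gM] := proj_quot_serial G i k; rewrite GE in g gM.
  split=> [rig|short].
    have [kn|nk] := ltnP k n; first by left; lia.
    right; suff : (kupisch P i < k + n)%N by lia.
    rewrite ltnNge; apply/negP => knc; apply: (serial_not_rigid gM) rig; first by lia.
    by apply/eqP; rewrite p0; lia.
  apply: (serial_rigid (c := kupisch P i) gM kc); last by case: short; lia.
    by apply/eqP; rewrite p0.
  by apply/eqP; rewrite p0; lia.
(* The left summand lists the lengths 1..n-1, the right one the lengths
   c_i-n+1..c_i; truncated subtraction may give the zero module there. *)
pose T := ('I_n * 'I_(n - 1) + 'I_n * 'I_n)%type.
have cardT : #|{: T}| = (n * (n - 1) + n ^ 2)%N.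
  by rewrite card_sum !card_prod !card_ord mulnn.
pose F (t : T) : rmodule A := match t with
  | inl (i, l) => proj_quot (vtx P i) l.+1
  | inr (i, l) => proj_quot (vtx P i) (kupisch P i - l)
  end.
have cover M : indecomposable M /\ rigid1 M -> exists t, mod_iso M (F t).
  case=> indM rM; have [i [k [k0 /eqP pk iso]]] := indecomposable_serial G indM.
  rewrite p0 -ltnNge in pk; rewrite GE in iso; have kc : (1 <= k <= kupisch P i)%N by lia.
  have /(rigidP i k kc) short : rigid1 (proj_quot (vtx P i) k).
    exact: rigid1_retract (mod_iso_retract (mod_iso_sym iso)) rM.
  case: (ltnP k n) => kn.
    have kn' : (k.-1 < n - 1)%N by lia.
    by exists (inl (i, Ordinal kn')); rewrite /F /= prednK.
  have ckn : (kupisch P i - k < n)%N by case: short; lia.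
  by exists (inr (i, Ordinal ckn)); rewrite /F /= subKn //; lia.
split=> //; rewrite -cardT; first exact: num_iso_classes_le cover.
apply/enat_supP => _ [M rM ->]; apply: (num_iso_classes_le (F := F)) => N [indN NM].
by apply: cover; split=> //; apply: rigid1_retract rM; apply/direct_summandP.
Qed.
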